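(* Let $n\ge 1$ be an integer. There exists an Abelian planar difference set of order $n$ if and only if the space $(A_n, d)$ admits a linear $1$-perfect code.
   Context: $A_n=\{(x_0,x_1,\ldots,x_n): x_i\in\mathbb{Z},\ \sum_{i=0}^n x_i=0\}$, with metric $d(\mathbf{x},\mathbf{y})=\frac12\sum_{i=0}^n|x_i-y_i|$. An Abelian planar difference set of order $n$ is a subset $D$ of cardinality $n+1$ in an Abelian group $G$ of order $n^2+n+1$ such that the differences $b-b'$, for ordered pairs of distinct $b,b'\in D$, are all different (equivalently, every nonzero element of $G$ can be written as $b-b'$ with $b,b'\in D$ in exactly one way). A code in $(A_n,d)$ is a subset of $A_n$; it is linear if it is a sublattice of $A_n$, i.e. closed under addition and subtraction (a subgroup). A code is $r$-perfect if the balls of radius $r$ (with respect to $d$, closed) centered at its elements are pairwise disjoint and cover $A_n$. *)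

(* Defs.v *)
From HB Require Import structures.
From mathcomp Require Import all_boot all_order all_algebra.
From mathcomp Require Import classical_sets.

Set Implicit Arguments.
Unset Strict Implicit.
Unset Printing Implicit Defensive.

Import Order.TTheory GRing.Theory Num.Theory.
Local Open Scope ring_scope.
Local Open Scope classical_set_scope.

Definition planar_difference_set (G : finZmodType) (n : nat) (D : {set G}) : Prop :=
  [/\ #|G| = (n ^ 2 + n + 1)%N,
      #|D| = n.+1 &
      forall a b c d : G, a \in D -> b \in D -> c \in D -> d \in D ->
        a != b -> c != d -> a - b = c - d -> a = c /\ b = d].

Definition An (n : nat) : set 'rV[int]_n.+1 :=
  [set x : 'rV[int]_n.+1 | \sum_(i < n.+1) x ord0 i = 0].
Arguments An n _ : clear implicits.

(* Rational-valued because of the factor 1/2; on [An n] the sum is always even. *)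
Definition An_dist (n : nat) (x y : 'rV[int]_n.+1) : rat :=
  2%:R^-1 * (\sum_(i < n.+1) `|x ord0 i - y ord0 i|)%:~R.

Definition An_ball (n : nat) (r : rat) (x : 'rV[int]_n.+1) : set 'rV[int]_n.+1 :=
  [set y | An n y /\ An_dist x y <= r].

Definition code (n : nat) (C : set 'rV[int]_n.+1) : Prop := C `<=` An n.

Definition linear_code (n : nat) (C : set 'rV[int]_n.+1) : Prop :=
  [/\ code C, C 0,
      forall x y, C x -> C y -> C (x + y) &
      forall x y, C x -> C y -> C (x - y)].

Definition perfect_code (n : nat) (r : rat) (C : set 'rV[int]_n.+1) : Prop :=
  [/\ code C,
      trivIset C (@An_ball n r) &
      \bigcup_(c in C) An_ball r c = An n].

(* Main.v *)
(* The unit ball around [x] in A_n is [x + S], where [S] consists of 0 and the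
   roots e_i - e_j. So a linear code is 1-perfect iff [S] is a transversal of it
   in A_n. Given a difference set {d_0, ..., d_n}, the homomorphism sending e_i to
   d_i is bijective on [S], and its kernel in A_n is the code. Conversely, given a
   code C, the classes of the e_i form a difference set in A_n / C, realised as
   Z^(n+1) / (C + Z e_0). *)

Require Import Defs.
From HB Require Import structures.
From mathcomp Require Import all_boot all_order all_algebra.
From mathcomp Require Import classical_sets.
From mathcomp Require Import boolp zify.

Set Implicit Arguments.
Unset Strict Implicit.
Unset Printing Implicit Defensive.

Import Order.TTheory GRing.Theory Num.Theory.
Local Open Scope ring_scope.

(* The quotient V / K is realised on the index type of a transversal [r]. *)
Lemma finite_quotient (V : zmodType) (K : V -> Prop) (T : finType) (r : T -> V) :
    K 0 -> (forall x y, K x -> K y -> K (x - y)) ->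
    (forall x, exists t, K (x - r t)) ->
    (forall s t, K (r s - r t) -> s = t) ->
  exists (G : finZmodType) (f : V -> G),
    [/\ #|G| = #|T|, {morph f : x y / x - y} & forall x, f x = 0 -> K x].
Proof.
move=> K0 KB /choice[q Kq] r_inj.
have KN x : K x -> K (- x) by move=> Kx; rewrite -sub0r; apply: KB.
have KD x y : K x -> K y -> K (x + y).
  by move=> Kx Ky; rewrite -[y]opprK; apply: KB => //; apply: KN.
have qP x y : K (x - y) -> q x = q y.
  move=> Kxy; apply: r_inj.
  suff -> : r (q x) - r (q y) = (x - y) - (x - r (q x)) + (y - r (q y)).
    by apply: KD => //; apply: KB.
  by rewrite [_ - (x - _)]addrC opprB !addrA !subrK.
have rqP x y : K (y - x) -> K (r (q x) - y).
  move=> Kxy; rewrite -opprB; apply: KN.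
  by rewrite -[y](subrK x) -addrA; apply: KD.
have qr t : q (r t) = t by apply: r_inj; apply: rqP; rewrite subrr.
pose add s t := q (r s + r t).
pose opp t := q (- r t).
(* By [qr] the map [q] is onto, and it carries the operations of [V] to [add] and [opp], so the
   group laws on [T] follow from those of [V]. *)
have qD x y : q (x + y) = add (q x) (q y).
  by apply: qP; rewrite opprD addrACA; apply: KD.
have qN x : q (- x) = opp (q x).
  by apply: qP; rewrite -opprD; apply: KN.
have addA : associative add.
  by move=> s t u; rewrite -(qr s) -(qr t) -(qr u) -!qD addrA.
have addC : commutative add by move=> s t; rewrite /add addrC.
have add0 : left_id (q 0) add by move=> t; rewrite -(qr t) -qD add0r.
have addN : left_inverse (q 0) opp add.
  by move=> t; rewrite -(qr t) -qN -qD addNr.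
pose G : finZmodType :=
  HB.pack T (GRing.isZmodule.Build T addA addC add0 addN).
exists G, q; split.
- by apply: (@bij_eq_card G T id); exists id.
- by move=> x y; rewrite qD qN.
(* The zero of [G] is [q 0]. Its representative [r (q 0)] may differ from 0 but lies in [K]. *)
- move=> x qx0; rewrite -[x](subrK (r (q x))); apply: KD => //.
  by rewrite qx0 -[r _]subr0; apply: rqP; rewrite subrr.
Qed.

(** * Unit balls and 1-perfect codes in terms of steps *)

Section Steps.
Variable n : nat.
Implicit Types (x y z : 'rV[int]_n.+1) (C : set 'rV[int]_n.+1).

Definition unit_vec (i : 'I_n.+1) : 'rV[int]_n.+1 := delta_mx ord0 i.

(* The difference vectors of a unit ball: [0] and [e_i - e_k] with [k != i],
   where [k = lift i j] makes the index type have n^2 + n + 1 elements. *)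
Definition step (t : option ('I_n.+1 * 'I_n)) : 'rV[int]_n.+1 :=
  if t is Some (i, j) then unit_vec i - unit_vec (lift i j) else 0.

Lemma card_steps : #|{: option ('I_n.+1 * 'I_n)}| = (n ^ 2 + n + 1)%N.
Proof. by rewrite card_option card_prod !card_ord mulSn addnC addn1 mulnn. Qed.

Lemma unit_vecE i k : unit_vec i ord0 k = (k == i)%:R.
Proof. by rewrite mxE eqxx. Qed.

Lemma stepE i j k :
  step (Some (i, j)) ord0 k = unit_vec i ord0 k - unit_vec (lift i j) ord0 k.
Proof. by rewrite !mxE. Qed.

Lemma An0 : An n 0.
Proof. by rewrite /An /= big1 // => i _; rewrite mxE. Qed.

Lemma AnB x y : An n x -> An n y -> An n (x - y).
Proof.
rewrite /An /= => x0 y0.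
under eq_bigr do rewrite !mxE.
by rewrite sumrB x0 y0 subrr.
Qed.

Lemma AnD x y : An n x -> An n y -> An n (x + y).
Proof.
by move=> Ax Ay; rewrite -[y]opprK -[- y]sub0r; apply/AnB/AnB/Ay/An0.
Qed.

Lemma sum_unit_vec i : \sum_k unit_vec i ord0 k = 1.
Proof.
under eq_bigr do rewrite unit_vecE.
by rewrite (bigD1 i) //= eqxx big1 ?addr0 // => k /negPf ->.
Qed.

Lemma An_step t : An n (step t).
Proof.
case: t => [[i j]|]; last exact: An0.
rewrite /An /=; under eq_bigr do rewrite stepE.
by rewrite sumrB !sum_unit_vec subrr.
Qed.

Lemma norm_step t : \sum_k `|step t ord0 k| <= 2.
Proof.
case: t => [[i j]|]; last by rewrite big1 // => k _; rewrite mxE normr0.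
apply: (@le_trans _ _ (\sum_k (unit_vec i ord0 k + unit_vec (lift i j) ord0 k))).
  apply: ler_sum => k _; rewrite stepE !unit_vecE.
  by case: eqP; case: eqP.
by rewrite big_split /= !sum_unit_vec.
Qed.

Lemma step_diff i k : i != k -> exists j, step (Some (i, j)) = unit_vec i - unit_vec k.
Proof. by move=> /unlift_some[j -> _]; exists j. Qed.

Lemma step_inj : injective step.
Proof.
(* The indices can be read off a nonzero step: [i] is the only coordinate with value 1, and
   [lift i j] the only one with value -1. *)
have diag i j : step (Some (i, j)) ord0 i = 1.
  rewrite stepE !unit_vecE eqxx.
  by rewrite (negPf (neq_lift i j)) subr0.
have pos i j k : step (Some (i, j)) ord0 k = 1 -> k = i.
  rewrite stepE !unit_vecE.
  by case: eqP => // _; case: eqP.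
have neg i j k : step (Some (i, j)) ord0 k = -1 -> k = lift i j.
  rewrite stepE !unit_vecE.
  by case: (k =P lift i j) => // _; case: eqP.
have low i j : step (Some (i, j)) ord0 (lift i j) = -1.
  rewrite stepE !unit_vecE eqxx.
  by rewrite eq_sym (negPf (neq_lift i j)) sub0r.
move=> [[i j]|] [[k l]|] // e.
- have ik : i = k by apply: (pos k l); rewrite -e diag.
  subst k; congr (Some (_, _)); apply: (@lift_inj _ i).
  by apply: (neg i l); rewrite -e low.
- by have := diag i j; rewrite e mxE.
- by have := diag k l; rewrite -e mxE.
Qed.

(** A nonzero [z] of coordinate sum 0 has a positive coordinate [i] and a negative coordinate [j].
    Subtracting e_i - e_j lowers the absolute values at both by 1, so a norm of at most 2 drops to
    0. *)
Lemma stepP z : An n z -> \sum_i `|z ord0 i| <= 2 -> exists t, z = step t.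
Proof.
move=> Az nz; have [->|z0] := eqVneq z 0; first by exists None.
have pos x : An n x -> x != 0 -> exists i, 0 < x ord0 i.
  move=> Ax x0; apply/existsP; apply: contraR x0; rewrite negb_exists => /forallP npos.
  have le0 k : x ord0 k <= 0 by rewrite leNgt.
  apply/eqP/rowP => i; rewrite mxE; apply/eqP; rewrite -oppr_eq0.
  have /psumr_eq0P : \sum_i (- x ord0 i) = 0 by rewrite sumrN Ax oppr0.
  by move=> -> // k _; rewrite oppr_ge0.
have [i zi] := pos z Az z0.
have [j] : exists j, 0 < (- z) ord0 j.
  by apply: pos; [rewrite -sub0r; apply: AnB An0 Az|rewrite oppr_eq0].
rewrite mxE => zj.
have ij : i != j.
  by apply: contraTneq zj => <-; rewrite oppr_gt0 -leNgt ltW.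
have [l el] := step_diff ij; exists (Some (i, l)); rewrite el.
pose w := z - (unit_vec i - unit_vec j).
suff w0 : w = 0 by apply/eqP; rewrite -subr_eq0 -/w w0.
have wE k : `|w ord0 k| = `|z ord0 k| - unit_vec i ord0 k - unit_vec j ord0 k.
  rewrite /w !(mxE, eqxx) /=.
  have [->|_] := eqVneq k i; first by rewrite (negPf ij); move: (z _ _) zi; lia.
  by have [->|_] := eqVneq k j; [move: (z _ _) zj|move: (z _ _)]; lia.
have : \sum_k `|w ord0 k| <= 0.
  under eq_bigr do rewrite wE.
  by rewrite !sumrB !sum_unit_vec -addrA -opprD subr_le0.
rewrite le_eqVlt ltNge sumr_ge0 // orbF => /eqP /psumr_eq0P w0.
by apply/rowP => k; rewrite [RHS]mxE; apply/normr0_eq0/w0.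
Qed.

Lemma An_ball1P x y : An n x -> An_ball 1 x y <-> exists t, y = x + step t.
Proof.
(* Doubling removes the factor 1/2 and turns the rational bound 1 into the integer bound 2. *)
have dist u v : (An_dist u v <= 1) = (\sum_i `|u ord0 i - v ord0 i| <= 2).
  rewrite /An_dist -(ler_pM2l (ltr0Sn rat 1)) mulrA divff // mul1r mulr1.
  by rewrite -[2%:R]/(2%:~R) ler_int.
move=> Ax; split => [[Ay] | [t ->]].
- rewrite dist => nxy.
  have [||t yx] := @stepP (y - x); first exact: AnB.
    rewrite (le_trans _ nxy) //; apply: ler_sum => i _.
    by rewrite !mxE distrC.
  by exists t; rewrite -yx addrC subrK.
- split; first by apply: AnD => //; apply: An_step.
  rewrite dist (le_trans _ (norm_step t)) //; apply: ler_sum => i _.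
  by rewrite distrC mxE addrAC subrr add0r.
Qed.

Lemma perfect_code1P C : linear_code C ->
  perfect_code 1 C <-> (forall x, An n x -> exists t, C (x - step t)) /\
                       (forall s t, C (step s - step t) -> s = t).
Proof.
move=> [CA C0 CD CB]; split => [[_ triv cover]|[cover uniq]].
- split => [x|s t Cst].
    rewrite -cover => -[c Cc /An_ball1P[]]; first exact: CA.
    by move=> t ->; exists t; rewrite addrK.
  (* The balls around the codewords 0 and [step s - step t] both contain [step s], so these centres
     coincide. *)
  apply: step_inj; apply/eqP; rewrite -subr_eq0 eq_sym; apply/eqP.
  apply: triv => //; exists (step s); split.
    by apply/An_ball1P; [exact: An0|exists s; rewrite add0r].
  by apply/An_ball1P; [exact: CA|exists t; rewrite subrK].
- split=> //.
    move=> c c' Cc Cc' [y [/(An_ball1P _ (CA _ Cc))[s ys]]].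
    move=> /(An_ball1P _ (CA _ Cc'))[t yt].
    have st : s = t.
      apply: uniq; suff -> : step s - step t = c' - c by apply: CB.
      by apply/eqP; rewrite subr_eq addrAC -yt ys [c + _]addrC addrK.
    by apply: (addIr (step s)); rewrite -ys yt st.
  apply/seteqP; split => [y [c Cc []] //|x Ax].
  have [t Ct] := cover x Ax; exists (x - step t) => //.
  by apply/An_ball1P; [exact: CA|exists t; rewrite subrK].
Qed.

End Steps.

(** * From difference sets to codes *)

Lemma code_of_difference_set (n : nat) (G : finZmodType) (D : {set G}) :
  planar_difference_set n D ->
  exists C : set 'rV[int]_n.+1, linear_code C /\ perfect_code 1 C.
Proof.
move=> [cardG cardD diffD].
pose d (i : 'I_n.+1) : G := enum_val (cast_ord (esym cardD) i).
have dD i : d i \in D by apply: enum_valP.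
have d_inj : injective d by move=> i j /enum_val_inj/cast_ord_inj.
pose phi (x : 'rV[int]_n.+1) : G := \sum_i d i *~ x ord0 i.
have phiB x y : phi (x - y) = phi x - phi y.
  by rewrite -sumrB; apply: eq_bigr => i _; rewrite !mxE mulrzBr.
have phi0 : phi 0 = 0 by rewrite -(subrr 0) phiB subrr.
have phi_unit i : phi (unit_vec i) = d i.
  rewrite /phi (bigD1 i) //= unit_vecE eqxx mulr1z big1 ?addr0 // => k.
  by rewrite unit_vecE => /negPf ->; rewrite mulr0z.
have phi_step_inj : injective (phi \o @step n).
  have neq0 i j : d i - d (lift i j) <> 0.
    by move=> /subr0_eq/d_inj/eqP; rewrite (negPf (neq_lift i j)).
  move=> [[i j]|] [[k l]|] //=; rewrite ?phi0 ?phiB ?phi_unit.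
  (* Two nonzero steps with the same image give equal differences of distinct elements of [D]. *)
  - case/diffD; rewrite ?dD ?(inj_eq d_inj) ?neq_lift // => /d_inj <-.
    by move=> /d_inj/lift_inj ->.
  - by move/neq0.
  - by move/esym/neq0.
pose C : set 'rV[int]_n.+1 := fun x => An n x /\ phi x = 0.
have CB x y : C x -> C y -> C (x - y).
  move=> [Ax x0] [Ay y0]; split; first exact: AnB.
  by rewrite phiB x0 y0 subrr.
have C0 : C 0 by split; [exact: An0|].
have linC : linear_code C.
  split=> //; first by move=> x [].
  by move=> x y Cx Cy; rewrite -[y]opprK -[- y]sub0r; apply/CB/CB.
exists C; split=> //; apply/(perfect_code1P linC); split => [x Ax|s t [_]].
(* Covering comes from counting: there are n^2 + n + 1 steps, as many as elements of [G], so [phi],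
   being injective on steps, takes every value on them. *)
- have /codomP[t xt] : phi x \in codom (phi \o @step n).
    by apply: inj_card_onto => //; rewrite card_steps cardG.
  exists t; split; first by apply: AnB => //; apply: An_step.
  by rewrite phiB xt subrr.
- by rewrite phiB => /subr0_eq/phi_step_inj.
Qed.

(** * From codes to difference sets *)

Lemma difference_set_of_code (n : nat) (C : set 'rV[int]_n.+1) :
  linear_code C -> perfect_code 1 C ->
  exists (G : finZmodType) (D : {set G}), planar_difference_set n D.
Proof.
move=> linC /(perfect_code1P linC)[cover uniq].
have [CA C0 CD CB] := linC.
(* [C \o shift] is the subgroup C + Z e_0. *)
pose shift (x : 'rV[int]_n.+1) := x - (\sum_i x ord0 i) *: unit_vec ord0.
have shiftB x y : shift (x - y) = shift x - shift y.
  rewrite /shift (eq_bigr (fun i => x ord0 i - y ord0 i)); last first.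
    by move=> i _; rewrite !mxE.
  by rewrite sumrB scalerBl opprD addrACA -opprD.
have shift_id x : An n x -> shift x = x.
  by rewrite /shift => ->; rewrite scale0r subr0.
have An_shift x : An n (shift x).
  rewrite /An /= (eq_bigr (fun i =>
    x ord0 i - (\sum_i x ord0 i) * unit_vec ord0 ord0 i)) => [|i _].
    by rewrite sumrB -mulr_sumr sum_unit_vec mulr1 subrr.
  by rewrite !mxE.
(* [shift] is the projection onto A_n along e_0 and fixes every step. Hence the steps, a transversal
   of [C] in A_n, are also one of C + Z e_0 in Z^(n+1). *)
have [] := @finite_quotient _ (C \o shift) _ (@step n).
- by rewrite /= shift_id //; apply: An0.
- by move=> x y /= Cx Cy; rewrite shiftB; apply: CB.
- move=> x; have [t Ct] := cover _ (An_shift x).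
  by exists t; rewrite /= shiftB (shift_id (step t)) //; apply: An_step.
- move=> s t /=; rewrite shift_id; first exact: uniq.
  by apply: AnB; apply: An_step.
move=> G [f [cardG fB fK]].
pose d i := f (unit_vec i).
have stepf s t : f (step s) = f (step t) -> s = t.
  move=> fst; apply: uniq; rewrite -(shift_id (step s - step t)).
    by apply: fK; rewrite fB fst subrr.
  by apply: AnB; apply: An_step.
have d_inj : injective d.
  (* If i and k were distinct, the nonzero step e_i - e_k would have the same image as the zero
     step. *)
  move=> i k dik; apply/eqP; apply: contraT => /step_diff[j ej].
  have /stepf// : f (step (Some (i, j))) = f (step None).
  by rewrite ej fB /= -/(d i) dik -(subrr 0) fB !subrr.
exists G, [set d i | i in [set: 'I_n.+1]]; split.
- by rewrite cardG card_steps.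
- by rewrite card_imset // cardsT card_ord.
move=> _ _ _ _ /imsetP[i _ ->] /imsetP[j _ ->] /imsetP[k _ ->] /imsetP[l _ ->].
rewrite !(inj_eq d_inj) => ij kl.
have [j' ej] := step_diff ij; have [l' el] := step_diff kl.
(* Both differences are images of steps, and [f] is injective on steps, so the steps agree index by
   index. *)
rewrite /d -!fB -ej -el => /stepf -[ik jl]; subst k l'.
split=> //; congr f; by move: el; rewrite ej => /addrI /oppr_inj.
Qed.

Theorem theorem3p1 (n : nat) (n_ge1 : (1 <= n)%N) :
  (exists (G : finZmodType) (D : {set G}), planar_difference_set n D) <->
  (exists C : set 'rV[int]_n.+1, linear_code C /\ perfect_code 1 C).
Proof.
split=> [[G [D]]|[C [linC perfC]]]; first exact: code_of_difference_set.
exact: difference_set_of_code linC perfC.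
Qed.
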